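(* For every integer $k\geq 3$, $$\operatorname{gr}_k(P_5:S_6^1)= \begin{cases} 26, & k=3;\\ 7, & 4\leq k\leq 6;\\ \left\lceil\frac{1+\sqrt{1+8k}}{2}\right\rceil, & k\geq 7. \end{cases}$$
   Context: All graphs are finite, simple and undirected. $K_n$ is the complete graph on $n$ vertices and $P_5$ is the path with $5$ vertices and $4$ edges. $S_t^r$ is the graph of order $t$ obtained from the star $K_{1,t-1}$ by adding $r$ pairwise independent edges between the leaves; thus $S_6^1$ is the star $K_{1,5}$ with one edge added between two leaves. A $k$-edge-coloring assigns to each edge one of $k$ colors; all $k$-edge-colorings are assumed exact, i.e. each of the $k$ colors is used at least once. An edge-colored graph is rainbow if all its edges have different colors and monochromatic if all its edges have a single color. A copy of a graph means a (not necessarily induced) subgraph isomorphic to it. For non-empty graphs $G,H$ (graphs with at least one edge) and a positive integer $k$, the Gallai-Ramsey number $\operatorname{gr}_k(G:H)$ is the minimum integer $N$ with $\binom{N}{2}\geq k$ (so that $K_N$ admits a $k$-edge-coloring) such that for all $n\geq N$, every $k$-edge-coloring of $K_n$ contains either a rainbow copy of $G$ or a monochromatic copy of $H$. *)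

(* Defs.v *)
From mathcomp Require Import all_boot all_order all_algebra.
From mathcomp Require Import reals.

Set Implicit Arguments.
Unset Strict Implicit.
Unset Printing Implicit Defensive.

Record sgraph := SGraph {
  vertex :> finType;
  adj : rel vertex;
  adj_sym : symmetric adj;
  adj_irr : irreflexive adj }.

Definition edges (G : sgraph) : {set {set G}} :=
  [set e : {set G} | [exists x, exists y, adj x y && (e == [set x; y])]].

Fact complete_adj_sym n : symmetric (fun i j : 'I_n => i != j).
Proof. by move=> i j; rewrite eq_sym. Qed.

Fact complete_adj_irr n : irreflexive (fun i j : 'I_n => i != j).
Proof. by move=> i; rewrite eqxx. Qed.

Definition complete_graph (n : nat) : sgraph :=
  SGraph (@complete_adj_sym n) (@complete_adj_irr n).

Definition path_adj (n : nat) (i j : 'I_n) : bool :=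
  (j == i.+1 :> nat) || (i == j.+1 :> nat).

Fact path_adj_sym n : symmetric (@path_adj n).
Proof. by move=> i j; rewrite /path_adj orbC. Qed.

Fact path_adj_irr n : irreflexive (@path_adj n).
Proof. by move=> i; rewrite /path_adj orbb (ltn_eqF (ltnSn _)). Qed.

Definition path_graph (n : nat) : sgraph :=
  SGraph (@path_adj_sym n) (@path_adj_irr n).

(* S_t^r, meant for 2 * r <= t.-1: the centre is 0, the leaves are            *)
(* 1, ..., t.-1, and the r extra edges are {1, 2}, {3, 4}, ..., {2r - 1, 2r}. *)
Definition star_edge (r i j : nat) : bool :=
  (i == 0) && (0 < j) || [&& odd i, j == i.+1 & j <= r.*2].

Definition star_adj (t r : nat) (i j : 'I_t) : bool :=
  star_edge r i j || star_edge r j i.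

Fact star_adj_sym t r : symmetric (@star_adj t r).
Proof. by move=> i j; rewrite /star_adj orbC. Qed.

Fact star_adj_irr t r : irreflexive (@star_adj t r).
Proof.
move=> i; rewrite /star_adj orbb /star_edge (ltn_eqF (ltnSn _)) andbF orbF.
by case: (val i).
Qed.

Definition star_graph (t r : nat) : sgraph :=
  SGraph (@star_adj_sym t r) (@star_adj_irr t r).

(* A k-edge-coloring of F is a function c on all sets of vertices, of which   *)
(* only the values on edges F are used.                                       *)
Definition exact_coloring (F : sgraph) (k : nat) (c : {set F} -> 'I_k) : Prop :=
  forall a : 'I_k, exists2 e, e \in edges F & c e = a.

Definition embedding (G F : sgraph) (f : G -> F) : Prop :=
  injective f /\ {homo f : x y / adj x y}.

Definition has_rainbow (G F : sgraph) (k : nat) (c : {set F} -> 'I_k) : Prop :=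
  exists2 f : G -> F, embedding f &
    {in edges G &, injective (fun e : {set G} => c (f @: e))}.

Definition has_monochromatic (H F : sgraph) (k : nat) (c : {set F} -> 'I_k)
  : Prop :=
  exists2 f : H -> F, embedding f &
    exists a : 'I_k, forall e, e \in edges H -> c (f @: e) = a.

Definition gallai_ramsey_bound (k : nat) (G H : sgraph) (N : nat) : Prop :=
  k <= 'C(N, 2) /\
  forall n, N <= n -> forall c : {set complete_graph n} -> 'I_k,
    exact_coloring c -> has_rainbow G c \/ has_monochromatic H c.

(* gr_k(G : H) = N *)
Definition is_gallai_ramsey (k : nat) (G H : sgraph) (N : nat) : Prop :=
  gallai_ramsey_bound k G H N /\
  forall M, gallai_ramsey_bound k G H M -> N <= M.

(* Main.v *)
(* A colouring in more than three colours has a rainbow P_4, and an edge of a  *)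
(* fourth colour; these span at most six vertices. Extending this partial      *)
(* colouring edge by edge, up to renaming of the colours, an exhaustive search *)
(* shows that on seven vertices a rainbow P_5 or a monochromatic S_6^1 always  *)
(* appears, and that on five or six vertices one of them appears as soon as    *)
(* there are seven colours. So from k = 7 on the value is the least N with     *)
(* k <= 'C(N, 2), and for 4 <= k <= 6 it is 7 because of K_6 with a            *)
(* monochromatic K_5. With three colours no P_5 is rainbow, so that 26 is the  *)
(* 3-colour Ramsey number of S_6^1: without a monochromatic S_6^1, a           *)
(* neighbourhood of size at least 5 in one colour avoids that colour, whence   *)
(* at most 5, 10 and 25 vertices for 1, 2 and 3 colours; the blow-up of the    *)
(* triangle-free 2-colouring of K_5 has 25 vertices.                           *)
Require Import Defs.
From mathcomp Require Import all_boot all_order all_algebra.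
From mathcomp Require Import reals zify.
From mathcomp Require boolp.

Set Implicit Arguments.
Unset Strict Implicit.
Unset Printing Implicit Defensive.

(** * Searching for rainbow paths *)

(** With at least four colours the upper bounds reduce to finite checks. Without a rainbow [P_4],
    two adjacent edges of different colours control the whole colouring and leave room for three
    colours only ([rainbow_P4]). So there are a rainbow [P_4] and an edge of a fourth colour;
    [search_sound] turns the exhaustive search from such a start into [four_colors_P5_or_star] (at
    least seven vertices) and [seven_colors_P5_or_star] (at least five vertices, seven colours).

    With three colours only stars matter. A neighbourhood of size at least 5 in one colour is free
    of that colour ([nbhd_uncolored]), so each degree is bounded by the maximal order for one colour
    fewer. In a set that is too large, every vertex then has degree at least 5 in every colour,
    which excludes monochromatic triangles and contradicts [ramsey33]: directly for two colours,
    inside a neighbourhood for three ([card_three_colors]).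

    The lower bounds come from [blowup_color] for [k = 3] and [pendant_color] for [4 <= k <= 6];
    from [k = 7] on they are the condition [k <= 'C(N, 2)] itself, solved by [ceil_bin2]. *)

Definition steps (T C : Type) (col : T -> T -> C) (p : seq T) : seq C :=
  if p is x :: q then pairmap col x q else [::].

Lemma steps_rcons (T C : Type) (col : T -> T -> C) x p z :
  steps col (rcons (x :: p) z) = rcons (steps col (x :: p)) (col (last x p) z).
Proof. by rewrite /= -!cats1 pairmap_cat. Qed.

Lemma steps_map (T U C : Type) (col : U -> U -> C) (f : T -> U) p :
  steps col (map f p) = steps (fun x y => col (f x) (f y)) p.
Proof. by case: p => // x p /=; elim: p x => //= y p IHp x; rewrite IHp. Qed.

Definition rainbow_path (T C : eqType) (col : T -> T -> C) (p : seq T) : bool :=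
  uniq p && uniq (steps col p).

Definition rainbow_P5 (T C : eqType) (col : T -> T -> C) : Prop :=
  exists2 p, size p = 5 & rainbow_path col p.

(* A vertex v of degree at least 5 in colour a which lies on a triangle of     *)
(* colour a, that is, a monochromatic S_6^1.                                   *)
Definition mono_star (T C : eqType) (col : T -> T -> C) : Prop :=
  exists v S a, [/\ uniq (v :: S), 4 < size S, {in S, forall u, col v u = a} &
    exists x y, [/\ x \in S, y \in S, x != y & col x y = a]].

(* In the search, w is a partial colouring: w x y is None if the edge is not   *)
(* coloured yet, and the colours are numbered in order of appearance. The path *)
(* p has edges of the distinct colours ls and is to be extended at its ends to *)
(* a rainbow path with d more edges. The conditionals here are not written     *)
(* with && and ||, since vm_compute would evaluate both arguments.             *)
Fixpoint extends (w : nat -> nat -> option nat) (n d : nat) (p ls : seq nat) : bool :=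
  if d is d'.+1 then
    has (fun z => if z \in p then false else
      if (if w z (head 0 p) is Some l
          then if l \in ls then false else extends w n d' (z :: p) (l :: ls)
          else false) then true
      else if w (last 0 p) z is Some l
           then if l \in ls then false else extends w n d' (rcons p z) (l :: ls)
           else false)
     (iota 0 n)
  else true.

Definition assign (w : nat -> nat -> option nat) (e : nat * nat) (l x y : nat) :=
  if (if x == e.1 then y == e.2 else if x == e.2 then y == e.1 else false) then Some l
  else w x y.

Definition starred (w : nat -> nat -> option nat) (n m : nat) : bool :=
  has (fun v => let row := map (w v) (iota 0 n) in
    has (fun l => if 4 < count_mem (Some l) row then
      let S := [seq u <- iota 0 n | w v u == Some l] in
      has (fun x => has (fun y => w x y == Some l) S) S
      else false)
    (iota 0 m)) (iota 0 n).

Definition total (w : nat -> nat -> option nat) (n : nat) : bool :=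
  all (fun y => all (fun x => w x y) (iota 0 y)) (iota 0 n).

(* The next edge gets one of the m colours in use or the new colour m; each    *)
(* branch must end in a rainbow P_5, a monochromatic S_6^1, or a full          *)
(* colouring with at most d colours.                                           *)
Fixpoint search (n d : nat) (todo : seq (nat * nat))
    (w : nat -> nat -> option nat) (m : nat) : bool :=
  if starred w n m then true else
  if todo is e :: todo' then
    all (fun l => let w' := assign w e l in
          if extends w' n 3 [:: e.1; e.2] [:: l] then true else
          search n d todo' w' (maxn m l.+1))
        (iota 0 m.+1)
  else (m <= d) && total w n.

Lemma search_cons n d e todo w m :
  search n d (e :: todo) w m = starred w n m ||
    all (fun l => extends (assign w e l) n 3 [:: e.1; e.2] [:: l] ||
                  search n d todo (assign w e l) (maxn m l.+1)) (iota 0 m.+1).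
Proof. by []. Qed.

Definition pairs_below (n : nat) : seq (nat * nat) :=
  [seq (i, j) | j <- iota 0 n, i <- iota 0 j].

(** Labels 0, 1, 2 lie on the path 0-1-2-3 and label 3 on a further edge. Its ends off the path are
    at most two vertices, numbered 4 and 5, hence [minn n 6]. *)
Definition search_from_P4 (n d : nat) : bool :=
  let P4 := [:: (0, 1); (1, 2); (2, 3)] in
  let w0 := assign (assign (assign (fun _ _ => None) (0, 1) 0) (1, 2) 1) (2, 3) 2 in
  all (fun e => let w := assign w0 e 3 in
        if extends w n 3 [:: e.1; e.2] [:: 3] then true else
        search n d [seq e' <- pairs_below n | e' \notin e :: P4] w 4)
      [seq e <- pairs_below (minn n 6) | e \notin P4].

(** * Soundness of the search *)

Lemma mono_star_map (T U C : eqType) (col : U -> U -> C) (f : T -> U) v S a :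
  {in v :: S &, injective f} -> uniq (v :: S) -> 4 < size S ->
  {in S, forall u, col (f v) (f u) = a} ->
  (exists x y, [/\ x \in S, y \in S, x != y & col (f x) (f y) = a]) ->
  mono_star col.
Proof.
move=> injf uS sS Sa [x [y [Sx Sy xy cxy]]].
exists (f v), (map f S), a; split.
- by rewrite -map_cons map_inj_in_uniq.
- by rewrite size_map.
- by move=> _ /mapP[u Su ->]; apply: Sa.
- exists (f x), (f y); split; rewrite ?map_f //.
  by apply: contra_neq xy => /injf; apply; rewrite inE ?Sx ?Sy orbT.
Qed.

Section SearchSoundness.

Variables (T C : eqType) (col : T -> T -> C) (x0 : T) (s : seq T).
Hypotheses (colC : forall x y, col x y = col y x) (us : uniq s).
Let n := size s.
Let vcol i j := col (nth x0 s i) (nth x0 s j).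
Let c0 := vcol 0 0.

(** Label [l] stands for the actual colour at position [l] of [L], which lists the colours in order
    of appearance. *)
Definition represents (w : nat -> nat -> option nat) (L : seq C) : Prop :=
  forall i j l, w i j = Some l -> [/\ i != j, l < size L & nth c0 L l = vcol i j].

Lemma nth_inj_below : {in gtn n &, injective (nth x0 s)}.
Proof. by move=> i j ltin ltjn /eqP; rewrite nth_uniq // => /eqP. Qed.

Lemma represents_assign w L e l : e.1 != e.2 ->
  represents w L -> l < size L -> nth c0 L l = vcol e.1 e.2 ->
  represents (assign w e l) L.
Proof.
move=> e12 wL ltl Ll i j l'; rewrite /assign.
case: (eqVneq i e.1) => [-> | _].
  by case: (eqVneq j e.2) => [-> [<-] // | _ /wL].
case: (eqVneq i e.2) => [-> | _ /wL //].
case: (eqVneq j e.1) => [-> [<-] | _ /wL //].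
by rewrite eq_sym /vcol colC.
Qed.

Lemma represents_rcons w L c : represents w L -> represents w (rcons L c).
Proof.
move=> wL i j l /wL[ij ltl <-]; rewrite size_rcons ltnW //.
by rewrite nth_rcons ltl.
Qed.

(** The labels match the edges of the path only up to permutation: a new label always goes to the
    front of [ls], while the new vertex may go to either end of [p]. *)
Lemma extends_sound w L d p ls : uniq L -> represents w L ->
  p != [::] -> uniq p -> all (gtn n) p ->
  uniq ls -> all (gtn (size L)) ls -> perm_eq (map (nth c0 L) ls) (steps vcol p) ->
  extends w n d p ls -> exists2 q, size q = d + size p & rainbow_path col q.
Proof.
move=> uL wL; elim: d p ls => [|d IHd] p ls p_n0 up pn uls lsL lsp.
  move=> _; exists (map (nth x0 s) p); rewrite ?size_map //.
  apply/andP; split.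
    rewrite map_inj_in_uniq // => i j /(allP pn) ? /(allP pn) ?.
    exact: nth_inj_below.
  rewrite steps_map -(perm_uniq lsp) map_inj_in_uniq //.
  move=> i j /(allP lsL) ltiL /(allP lsL) ltjL /eqP.
  by rewrite nth_uniq // => /eqP.
have step p' ls' x y z l : z \notin p -> z < n -> w x y = Some l ->
    l \notin ls -> perm_eq p' (z :: p) -> ls' = l :: ls ->
    perm_eq (steps vcol p') (vcol x y :: steps vcol p) ->
    extends w n d p' ls' ->
    exists2 q, size q = d.+1 + size p & rainbow_path col q.
  move=> pz zn /wL[_ ltl Ll] lsl p'E -> stepsE /IHd[] //.
  - by rewrite -size_eq0 (perm_size p'E).
  - by rewrite (perm_uniq p'E) /= pz.
  - by rewrite (perm_all _ p'E) /= pn andbT.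
  - by rewrite /= lsl.
  - by rewrite /= ltl.
  - by rewrite perm_sym (perm_trans stepsE) //= Ll perm_cons perm_sym.
  by move=> q sq; exists q; rewrite // sq (perm_size p'E) addnS.
move=> /hasP[z]; rewrite mem_iota add0n => /andP[_ zn].
case: ifP => // /negbT pz; case: ifP => [+ _ | _].
  case wzl: (w _ _) => [l|] //; case: ifP => // /negbT lsl.
  apply: step pz zn wzl lsl _ _ _ => //.
  by case: (p) p_n0 => // x p1 _ /=.
case wzl: (w _ _) => [l|] //; case: ifP => // /negbT lsl.
apply: step pz zn wzl lsl _ _ _ => //; first by rewrite perm_rcons.
by case: (p) p_n0 => // x p' _; rewrite steps_rcons perm_rcons.
Qed.

Lemma starred_sound w L m : represents w L -> starred w n m -> mono_star col.
Proof.
move=> wL /hasP[v]; rewrite mem_iota add0n => /andP[_ vn] /hasP[l _] /=.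
case: ifP => // lt4 /hasP[x Sx /hasP[y Sy /eqP wxy]].
set S := filter _ _ in Sx Sy.
have Sl u : u \in S -> u < n /\ w v u = Some l.
  by rewrite mem_filter mem_iota => /and3P[/eqP].
apply: (@mono_star_map _ _ _ col (nth x0 s) v S (nth c0 L l)).
- by move=> i j; rewrite !inE => /predU1P[-> | /Sl[? _]] /predU1P[-> | /Sl[? _]] //;
    apply: nth_inj_below.
- rewrite /= filter_uniq ?iota_uniq // andbT.
  by apply/negP => /Sl[_ /wL[]]; rewrite eqxx.
- by rewrite size_filter; rewrite count_map in lt4.
- by move=> u /Sl[_ /wL[]].
- by have [xy _ cxy] := wL _ _ _ wxy; exists x, y.
Qed.

Lemma total_sound w L : represents w L -> total w n ->
  {in s &, forall x y, x != y -> col x y \in L}.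
Proof.
move=> wL tw.
have le i j : i < j -> j < n -> vcol i j \in L.
  move=> ltij ltjn; move: tw => /allP/(_ j); rewrite mem_iota => /(_ ltjn).
  move=> /allP/(_ i); rewrite mem_iota => /(_ ltij).
  case wij: (w i j) => [l|] // _.
  by have [_ ltl <-] := wL _ _ _ wij; apply: mem_nth.
move=> _ _ /(nthP x0)[i ltin <-] /(nthP x0)[j ltjn <-].
by rewrite nth_uniq // neq_ltn => /orP[/le | /le]; [|rewrite colC]; apply.
Qed.

(** The actual colour of the next edge is either in [L] or appended to it, so its index in the
    updated list [L'] is one of the labels tried. Following these labels gives the branch that
    describes [col]. *)
Lemma search_sound d todo w L : uniq L -> represents w L ->
  all (fun e => e.1 < e.2 < n) todo -> search n d todo w (size L) ->
  [\/ rainbow_P5 col, mono_star col |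
      exists2 L' : seq C, size L' <= d &
        {in s &, forall x y, x != y -> col x y \in L'}].
Proof.
elim: todo w L => [|e todo IHtodo] w L uL wL.
  move=> _ /=; case: ifP => [/(starred_sound wL) | _ /andP[sL /(total_sound wL)]].
    by constructor 2.
  by constructor 3; exists L.
case/andP=> /andP[lte12 lte2n] todon; rewrite search_cons.
case/orP=> [/(starred_sound wL) | /allP alll]; first by constructor 2.
have e12 : e.1 != e.2 by rewrite neq_ltn lte12.
have lte1n := ltn_trans lte12 lte2n.
pose c := vcol e.1 e.2.
pose L' := if c \in L then L else rcons L c.
have uL' : uniq L' by rewrite /L'; case: ifPn => //; rewrite rcons_uniq uL => ->.
have wL' : represents w L' by rewrite /L'; case: ifP => // _; apply: represents_rcons.
have L'c : c \in L' by rewrite /L'; case: ifP => // _; rewrite mem_rcons mem_head.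
pose l := index c L'.
have ltl : l < size L' by rewrite index_mem.
have Ll : nth c0 L' l = c by rewrite nth_index.
have w'L' := represents_assign e12 wL' ltl Ll.
have sL' : size L' = maxn (size L) l.+1.
  rewrite /l /L'; case: ifPn => [cL | cL].
    by apply/esym/maxn_idPl; rewrite index_mem.
  by rewrite -cats1 index_cat (negPf cL) /= eqxx addn0 size_cat addn1;
    apply/esym/maxn_idPr.
have: l \in iota 0 (size L).+1.
  rewrite mem_iota /= add0n ltnS /l /L'; case: ifPn => cL.
    by rewrite index_size.
  by rewrite -cats1 index_cat (negPf cL) /= eqxx addn0.
move/alll; case/orP=> [ext |]; last first.
  by rewrite -sL'; apply: IHtodo.
constructor 1.
have [] := extends_sound uL' w'L' _ _ _ _ _ _ ext; rewrite //= ?Ll //.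
- by rewrite inE andbT.
- by rewrite lte1n lte2n.
- by rewrite ltl.
- by move=> q sq; exists q.
Qed.

End SearchSoundness.

(** * Colourings in many colours *)

(** More than [d] colours occur on edges; lists make this meaningful for any [eqType] of colours. *)
Definition needs_colors (T C : eqType) (col : T -> T -> C) (d : nat) : Prop :=
  forall L : seq C, size L <= d -> exists x y, x != y /\ col x y \notin L.

(** If adjacent edges always agree, all edges at [x] share one colour, and any other edge is
    adjacent to one of them. *)
Lemma bicolored_P3 (T C : eqType) (col : T -> T -> C) :
  (forall x y, col x y = col y x) -> needs_colors col 1 ->
  ~ (forall a b c, uniq [:: a; b; c] -> col a b = col b c).
Proof.
move=> colC nc H; have [x [y [xy _]]] := nc [::] isT.
have [u [v [uv]]] := nc [:: col x y] isT; rewrite inE => /eqP[].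
have Hx z : z != x -> col x z = col x y.
  move=> zx; have [-> // | zy] := eqVneq z y.
  by rewrite colC; apply: H; rewrite /= !inE negb_or zx zy xy.
have [eq_ux | ux] := eqVneq u x; first by rewrite eq_ux Hx // eq_sym -eq_ux.
have [-> | vx] := eqVneq v x; first by rewrite colC Hx.
by rewrite -(Hx u ux); symmetry; apply: H; rewrite /= !inE negb_or eq_sym ux eq_sym vx uv.
Qed.

(** Take differently coloured edges [ab] and [bc]. Without a rainbow [P_4], every edge of another
    colour has the colour of [ac] ([Gac]), so three colours cover everything. *)
Lemma rainbow_P4 (T C : eqType) (col : T -> T -> C) :
  (forall x y, col x y = col y x) -> needs_colors col 3 ->
  ~ (forall p, size p = 4 -> ~~ rainbow_path col p).
Proof.
move=> colC nc noP4.
have nc1 : needs_colors col 1 by move=> L sL; apply: nc; apply: leq_trans sL _.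
apply: (bicolored_P3 colC nc1) => a b c; rewrite /= !inE negb_or andbT.
case/andP=> /andP[/eqP ab /eqP ac] /eqP bc.
have [// | /eqP ab_bc] := eqVneq (col a b) (col b c).
have NP w x y z : w <> x -> w <> y -> w <> z -> x <> y -> x <> z -> y <> z ->
    [\/ col w x = col x y, col w x = col y z | col x y = col y z].
  move=> wx wy wz xy xz yz; have := noP4 [:: w; x; y; z] erefl.
  rewrite /rainbow_path /= !inE !negb_or !andbT.
  rewrite (introN eqP wx) (introN eqP wy) (introN eqP wz) (introN eqP xy).
  rewrite (introN eqP xz) (introN eqP yz) /= !negb_and !negbK.
  by case/orP=> [/orP[] | ] /eqP ?; [constructor 1 | constructor 2 | constructor 3].
suff Gac p q : p <> q -> col p q <> col a b -> col p q <> col b c -> col p q = col a c.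
  have [p [q []]] := nc [:: col a b; col b c; col a c] isT.
  by rewrite !inE !negb_or => /eqP pq /and3P[/eqP ? /eqP ? /eqP[]]; apply: Gac.
have baE := colC b a; have cbE := colC c b; have caE := colC c a.
pose out x := [/\ x <> a, x <> b & x <> c].
have outb x : out x -> col b x <> col a b -> col b x <> col b c -> col b x = col a c.
  move=> [xa xb xc] Ha Hc; have xbE := colC x b.
  by destruct (NP x b a c); try congruence; destruct (NP x b c a); congruence.
have outac x : out x -> (col a x = col a b \/ col a x = col b c) /\
                        (col c x = col a b \/ col c x = col b c).
  move=> [xa xb xc]; have xaE := colC x a; have xcE := colC x c.
  by split; [destruct (NP x a b c) | destruct (NP x c b a)]; try congruence;
    solve [left; congruence | right; congruence].
(* If [xy] had a third colour, then [ax], [bx], [cx] would have the colours of [ab], [xy], [bc], and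
   [a, x, b, c] would be a rainbow path. *)
have outout x y : out x -> out y -> x <> y -> col x y = col a b \/ col x y = col b c.
  move=> ox oy xy; have [xa xb xc] := ox; have [ya yb yc] := oy.
  have [/eqP | /eqP Ha] := eqVneq (col x y) (col a b); first by left; apply/eqP.
  have [/eqP | /eqP Hc] := eqVneq (col x y) (col b c); first by right; apply/eqP.
  have [ax cx] := outac x ox.
  have xbE := colC x b.
  have cxE : col c x = col b c.
    by case: cx => //; destruct (NP b c x y); congruence.
  have axE : col a x = col a b.
    by case: ax => //; destruct (NP b a x y); congruence.
  have bxE : col b x = col x y.
    by destruct (NP a b x y); try congruence; destruct (NP c b x y); congruence.
  by destruct (NP a x b c); congruence.
have outE x : x <> b -> [\/ x = a, x = c | out x].
  move=> xb; have [|/eqP xa] := eqVneq x a; first by constructor 1.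
  by have [|/eqP xc] := eqVneq x c; [constructor 2 | constructor 3].
have Gb x : b <> x -> col b x <> col a b -> col b x <> col b c -> col b x = col a c.
  by move=> bx; case: (outE x (nesym bx)) => [->|->|/outb //]; congruence.
move=> pq Ha Hc; have qpE := colC q p.
have [pb | /eqP pb] := eqVneq p b; first by rewrite pb in pq Ha Hc *; apply: Gb.
have [qb | /eqP qb] := eqVneq q b.
  by rewrite qb in pq Ha Hc *; rewrite colC; apply: Gb; rewrite 1?colC; congruence.
case: (outE p pb) => [pa | pc | op].
- by case: (outE q qb) => [qa | qc | /outac[[?|?] [?|?]]]; congruence.
- by case: (outE q qb) => [qa | qc | /outac[[?|?] [?|?]]]; congruence.
case: (outE q qb) => [qa | qc | oq]; last by case: (outout p q op oq pq).
- by case: (outac p op) => -[] ? _; congruence.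
- by case: (outac p op) => _ [] ?; congruence.
Qed.

(** * From the search to arbitrary colourings *)

Lemma mem_pairs_below n i j : ((i, j) \in pairs_below n) = (i < j < n).
Proof.
apply/allpairsPdep/idP => [[j' [i' []]] | /andP[ltij ltjn]].
  by rewrite !mem_iota => /andP[_ ltjn] /andP[_ ltij] [-> ->]; apply/andP.
by exists j, i; rewrite !mem_iota ltij ltjn.
Qed.

Lemma search_from_P4_sound (T C : eqType) (col : T -> T -> C) a b c e t p q d :
  let s := [:: a, b, c, e & t] in
  (forall x y, col x y = col y x) -> uniq s ->
  rainbow_path col [:: a; b; c; e] -> p \in take 6 s -> q \in take 6 s -> p != q ->
  col p q \notin [:: col a b; col b c; col c e] -> search_from_P4 (size s) d ->
  [\/ rainbow_P5 col, mono_star col |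
      exists2 L : seq C, size L <= d &
        {in s &, forall x y, x != y -> col x y \in L}].
Proof.
move=> s colC us /andP[_ uL0] ps qs pq; set L0 := [:: _; _; _] => cL0 /allP srch.
wlog ltij : p q ps qs pq cL0 / index p s < index q s.
  move=> W; case: (ltngtP (index p s) (index q s)) => [ltpq | ltqp | eqpq].
  - exact: (W p q).
  - by apply: (W q p); rewrite // 1?eq_sym // colC.
  by case/eqP: pq; rewrite -(nth_index a (mem_take ps)) eqpq nth_index ?(mem_take qs).
pose i := index p s; pose j := index q s.
have ltj6 : j < 6 by rewrite -in_take ?(mem_take qs).
have ltjs : j < size s by rewrite index_mem (mem_take qs).
have colij : col (nth a s i) (nth a s j) = col p q.
  by rewrite !nth_index ?(mem_take qs) ?(mem_take ps).
have ij : i != j by rewrite neq_ltn ltij.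
have notP4 : (i, j) \notin [:: (0, 1); (1, 2); (2, 3)].
  apply: contra cL0 => ijP; rewrite -colij; move: ijP.
  by rewrite !inE => /or3P[] /eqP[-> ->] /=; rewrite eqxx ?orbT.
pose P4 := [:: (0, 1); (1, 2); (2, 3)].
pose w0 := assign (assign (assign (fun _ _ => None) (0, 1) 0) (1, 2) 1) (2, 3) 2.
pose w := assign w0 (i, j) 3.
pose todo := [seq e' <- pairs_below (size s) | e' \notin (i, j) :: P4].
have: extends w (size s) 3 [:: i; j] [:: 3] || search (size s) d todo w 4.
  by apply: (srch (i, j)); rewrite mem_filter notP4 mem_pairs_below leq_min ltij ltjs ltj6.
pose L := rcons L0 (col p q).
have uL : uniq L by rewrite rcons_uniq cL0.
have wL : represents col a s w L by do 4![apply: (represents_assign colC) => //].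
have ltis := ltn_trans ltij ltjs.
case/orP=> [ext |]; last first.
  apply: (search_sound colC us uL wL).
  by apply/allP => -[x y]; rewrite mem_filter mem_pairs_below => /andP[].
constructor 1; have [] := extends_sound us uL wL _ _ _ _ _ _ ext.
- by [].
- by rewrite /= inE ij.
- by rewrite /= ltis ltjs.
- by [].
- by [].
- by rewrite /= colij.
- by move=> r sr; exists r.
Qed.

Lemma uniq_extend (T : finType) (s : seq T) m : uniq s -> size s <= m <= #|T| ->
  exists t, uniq (s ++ t) /\ size (s ++ t) = m.
Proof.
move=> us /andP[sm mT]; pose r := [seq x <- enum T | x \notin s].
have ur : uniq r by rewrite filter_uniq ?enum_uniq.
have sr : size r = #|T| - size s.
  by rewrite -(card_uniqP us) -(cardC (mem s)) addKn cardE /enum_mem -enumT size_filter.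
exists (take (m - size s) r); split.
  rewrite cat_uniq us take_uniq // andbT.
  by apply/hasPn => x /mem_take; rewrite mem_filter => /andP[].
by rewrite size_cat size_takel ?subnKC // sr leq_sub2r.
Qed.

(** The vertices of a rainbow [P_4] come first, then the ends of a fourth-coloured edge that are off
    the path, then arbitrary vertices up to [m]. *)
Lemma search_seq (T : finType) (C : eqType) (col : T -> T -> C) m d :
  (forall x y, col x y = col y x) -> needs_colors col 3 ->
  minn 6 #|T| <= m <= #|T| -> search_from_P4 m d ->
  exists s : seq T, [/\ uniq s, size s = m &
    [\/ rainbow_P5 col, mono_star col |
        exists2 L : seq C, size L <= d &
          {in s &, forall x y, x != y -> col x y \in L}]].
Proof.
move=> colC nc /andP[le6m lemT] srch.
have [/existsP[[P4 /= sP4] rP4] | noP4] :=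
    boolP [exists p : 4.-tuple T, rainbow_path col p]; last first.
  case: (rainbow_P4 colC nc) => p /eqP sp; apply: contra noP4 => rp.
  by apply/existsP; exists (Tuple sp).
case: P4 sP4 rP4 => [|a [|b [|c [|e []]]]] // _ rP4.
have [p [q [pq cpq]]] := nc (steps col [:: a; b; c; e]) isT.
pose P4 := [:: a; b; c; e]; pose s0 := P4 ++ [seq x <- [:: p; q] | x \notin P4].
have us0 : uniq s0.
  have [uP4 _] := andP rP4; rewrite cat_uniq uP4 filter_uniq ?andbT.
    by apply/hasPn => x; rewrite mem_filter => /andP[].
  by rewrite /= inE pq.
have ss06 : size s0 <= 6.
  by rewrite size_cat size_filter (leq_add2l 4 _ 2) -[2]/(size [:: p; q]) count_size.
have ss0m : size s0 <= m <= #|T|.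
  rewrite lemT andbT; apply: leq_trans le6m; rewrite leq_min ss06.
  by rewrite -(card_uniqP us0) max_card.
have [t [ust sst]] := uniq_extend us0 ss0m.
exists (s0 ++ t); split=> //; move: (ust) (sst); rewrite -catA => ust' sst'.
have in_take6 x : x \in s0 -> x \in take 6 (s0 ++ t).
  move=> xs0; have xs : x \in s0 ++ t by rewrite mem_cat xs0.
  rewrite (in_take _ xs) index_cat xs0.
  by apply: leq_trans ss06; rewrite index_mem.
have ps0 : p \in s0 by rewrite mem_cat mem_filter mem_head andbT orbN.
have qs0 : q \in s0 by rewrite mem_cat mem_filter !inE eqxx orbT andbT orbN.
apply: (@search_from_P4_sound _ _ col a b c e _ p q) => //.
- exact: in_take6 ps0.
- exact: in_take6 qs0.
- by rewrite sst'.
Qed.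

(** Bound 0 lets no colouring survive, since at least four labels are in use. Bound 6 is needed on
    six vertices, where the pendant colouring with six colours survives. *)
Lemma search_7 : search_from_P4 7 0. Proof. by vm_compute. Qed.
Lemma search_6 : search_from_P4 6 6. Proof. by vm_compute. Qed.
Lemma search_5 : search_from_P4 5 6. Proof. by vm_compute. Qed.

Lemma four_colors_P5_or_star (T : finType) (C : eqType) (col : T -> T -> C) :
  (forall x y, col x y = col y x) -> 6 < #|T| -> needs_colors col 3 ->
  rainbow_P5 col \/ mono_star col.
Proof.
move=> colC T7 nc.
have [|s [us ss]] := @search_seq T C col 7 0 colC nc _ search_7.
  by rewrite (minn_idPl (ltnW T7)) T7.
case=> [? | ? | [L]]; [by left | by right |].
rewrite leqn0 size_eq0 => /eqP-> inL.
case: s us ss inL => [|x [|y s]] //= /andP[+ _] _ inL.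
rewrite inE negb_or => /andP[xy _].
by have := inL x y; rewrite !inE !eqxx orbT => /(_ isT isT xy).
Qed.

Lemma seven_colors_P5_or_star (T : finType) (C : eqType) (col : T -> T -> C) :
  (forall x y, col x y = col y x) -> 4 < #|T| -> needs_colors col 6 ->
  rainbow_P5 col \/ mono_star col.
Proof.
move=> colC T5 nc6.
have nc3 : needs_colors col 3 by move=> L sL; apply: nc6; apply: leq_trans sL _.
have [T7 | leT6] := ltnP 6 #|T|; first exact: four_colors_P5_or_star.
have [||s [us ss]] := @search_seq T C col #|T| 6 colC nc3.
- by rewrite geq_minr leqnn.
- move: T5; rewrite leq_eqVlt => /predU1P[<- | T6]; first exact: search_5.
  have -> : #|T| = 6 by apply/eqP; rewrite eqn_leq leT6.
  exact: search_6.
case=> [? | ? | [L sL inL]]; [by left | by right |].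
have [x [y [xy /negP[]]]] := nc6 L sL.
have inT z : z \in s.
  have sT : {subset s <= enum T} by move=> ? _; rewrite mem_enum.
  by rewrite (uniq_min_size us sT _).2 ?mem_enum // ss cardT.
exact: inL.
Qed.

(** * Copies in complete graphs *)

Definition edge_color n k (c : {set complete_graph n} -> 'I_k) (x y : 'I_n) : 'I_k :=
  c [set x; y].

Lemma edge_colorC n k (c : {set complete_graph n} -> 'I_k) x y :
  edge_color c x y = edge_color c y x.
Proof. by rewrite /edge_color setUC. Qed.

Lemma edgesP (G : sgraph) (e : {set G}) :
  reflect (exists x y, adj x y /\ e = [set x; y]) (e \in edges G).
Proof.
rewrite inE; apply: (iffP existsP) => [[x /existsP[y /andP[xy /eqP->]]] | [x [y [xy ->]]]].
  by exists x, y.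
by exists x; apply/existsP; exists y; rewrite xy eqxx.
Qed.

Lemma path_edgesP n (e : {set path_graph n.+1}) :
  reflect (exists2 i, i < n & e = [set inord i; inord i.+1 : 'I_n.+1])
    (e \in edges (path_graph n.+1)).
Proof.
apply: (iffP (edgesP _)) => [[x [y [xy ->]]] | [i ltin ->]]; last first.
  exists (inord i), (inord i.+1); split=> //.
  by rewrite /= /path_adj !inordK ?eqxx // ltnW.
have [] := orP xy => /eqP def; [exists x | exists y].
- by rewrite -ltnS -def.
- by rewrite -def !inord_val.
- by rewrite -ltnS -def.
- by rewrite -def !inord_val setUC.
Qed.

Lemma star_edgesP t r (e : {set star_graph t r}) : e \in edges (star_graph t r) ->
  exists x y : 'I_t, e = [set x; y] /\ star_edge r x y.
Proof.
case/edgesP=> x [y [/orP[xy | yx] ->]]; first by exists x, y.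
by exists y, x; rewrite setUC.
Qed.

Lemma embedding_complete (G : sgraph) n (f : G -> complete_graph n) :
  injective f -> embedding f.
Proof.
move=> injf; split=> // x y xy /=; rewrite (inj_eq injf).
by apply: contraTneq xy => ->; rewrite adj_irr.
Qed.

Lemma rainbow_P5_has_rainbow n k (c : {set complete_graph n} -> 'I_k) :
  rainbow_P5 (edge_color c) -> has_rainbow (path_graph 5) c.
Proof.
case=> -[|x p] // [sp] /andP[up uc].
pose f (i : path_graph 5) : complete_graph n := nth x (x :: p) (i : 'I_5).
have cf i : i < 4 ->
    c (f @: [set inord i; inord i.+1 : 'I_5]) =
    nth (edge_color c x x) (steps (edge_color c) (x :: p)) i.
  move=> lti4; rewrite imsetU1 imset_set1 /= (nth_pairmap x) ?sp //.
  by rewrite /f !inordK // ltnW.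
exists f.
  apply: embedding_complete => i j /eqP; rewrite nth_uniq ?sp /= ?sp ?ltn_ord //.
  by move=> /eqP/val_inj.
move=> _ _ /path_edgesP[i ltin ->] /path_edgesP[j ltjn ->].
by rewrite !cf // => /eqP; rewrite nth_uniq ?size_pairmap ?sp // => /eqP->.
Qed.

Lemma mono_star_has_monochromatic n k (c : {set complete_graph n} -> 'I_k) :
  mono_star (edge_color c) -> has_monochromatic (star_graph 6 1) c.
Proof.
case=> v [S [a [/= /andP[vS uS] sS Sa [x [y [Sx Sy xy cxy]]]]]].
(* The ends of the extra edge must be leaves 1 and 2; three further leaves complete the five. *)
pose l := [:: x, y & take 3 (rem y (rem x S))].
have Syx : y \in rem x S by rewrite (mem_rem_uniq x uS) !inE eq_sym xy.
have rest z : z \in take 3 (rem y (rem x S)) -> [/\ z \in S, z != x & z != y].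
  move=> /mem_take; rewrite (mem_rem_uniq _ (rem_uniq _ uS)) !inE.
  by case/andP=> zy; rewrite (mem_rem_uniq _ uS) !inE => /andP[].
have lS z : z \in l -> z \in S by rewrite !inE => /or3P[/eqP->|/eqP->|/rest[]].
have sl : size l = 5.
  by rewrite /= size_takel // !size_rem //; case: (size S) sS => [|[|[|[]]]].
have us : uniq (v :: l).
  rewrite /= !inE !negb_or xy take_uniq ?rem_uniq //= andbT -!andbA.
  apply/and5P; split.
  - by apply: contraNneq vS => ->.
  - by apply: contraNneq vS => ->.
  - by apply/negP => /rest[vS' _ _]; rewrite vS' in vS.
  - by apply/negP => /rest[_ /eqP].
  - by apply/negP => /rest[_ _ /eqP].
pose f (i : star_graph 6 1) : complete_graph n := nth v (v :: l) (i : 'I_6).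
exists f.
  have svl : size (v :: l) = 6 by rewrite -[LHS]/(size l).+1 sl.
  apply: embedding_complete => i j /eqP.
  by rewrite /f nth_uniq ?svl ?ltn_ord // => /eqP/val_inj.
exists a => _ /star_edgesP[i [j [-> ij]]].
rewrite imsetU1 imset_set1; case/orP: ij => [/andP[/eqP i0 j0] | /and3P[oi /eqP ji lej2]].
  rewrite /f i0 /=; case: j j0 => -[|j] //= ltj6 _.
  by apply: Sa; apply: lS; rewrite mem_nth // -/l sl.
have i1 : i = 1 :> nat by rewrite ji in lej2; case: (i : nat) oi lej2 => [|[|]].
by rewrite /f ji i1.
Qed.

(** * Three colours *)

Section Ramsey.

Variables (T : finType) (C : eqType) (col : T -> T -> C).
Hypothesis colC : forall x y, col x y = col y x.

Definition nbhd (A : {set T}) (a : C) (v : T) : {set T} :=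
  [set u in A | (u != v) && (col v u == a)].

Lemma nbhdP (A : {set T}) a v u :
  reflect [/\ u \in A, u != v & col v u = a] (u \in nbhd A a v).
Proof.
by rewrite inE; apply: (iffP and3P) => -[? ?]; [move/eqP | move=> ->; rewrite eqxx].
Qed.

Lemma nbhd_uncolored (A : {set T}) a v : ~ mono_star col -> 4 < #|nbhd A a v| ->
  {in nbhd A a v &, forall x y, x != y -> col x y != a}.
Proof.
move=> nostar ltN x y Nx Ny xy; apply/eqP => cxy; apply: nostar.
exists v, (enum (nbhd A a v)), a; split.
- by rewrite /= enum_uniq mem_enum andbT; apply/nbhdP => -[_ /eqP].
- by rewrite -cardE.
- by move=> u; rewrite mem_enum => /nbhdP[].
- by exists x, y; rewrite !mem_enum.
Qed.

Definition colored_by (A : {set T}) (L : seq C) : Prop :=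
  {in A &, forall x y, x != y -> col x y \in L}.

Lemma colored_by_perm (A : {set T}) L L' :
  perm_eq L L' -> colored_by A L -> colored_by A L'.
Proof. by move=> LL' AL x y Ax Ay xy; rewrite -(perm_mem LL'); apply: AL. Qed.

Lemma colored_nbhd (A : {set T}) a v L : ~ mono_star col ->
  colored_by A (a :: L) -> 4 < #|nbhd A a v| -> colored_by (nbhd A a v) L.
Proof.
move=> nostar AL ltN x y Nx Ny xy; have /nbhdP[Ax _ _] := Nx; have /nbhdP[Ay _ _] := Ny.
have := AL x y Ax Ay xy.
by rewrite inE (negPf (nbhd_uncolored nostar ltN Nx Ny xy)).
Qed.

Lemma card_nbhd (A : {set T}) L v : colored_by A L -> v \in A ->
  #|A| <= 1 + \sum_(a <- L) #|nbhd A a v|.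
Proof.
move=> AL Av; rewrite (cardsD1 v) Av leq_add2l.
have {AL}: {in A :\ v, forall u, col v u \in L}.
  by move=> u; rewrite !inE => /andP[uv Au]; apply: AL; rewrite // eq_sym.
have: A :\ v \subset A :\ v by [].
move: {1 3 4}(A :\ v) => B; elim: L B => [|a L IHL] B sBA BL.
  rewrite big_nil leqn0 cards_eq0; apply/eqP/setP => u; rewrite inE.
  by apply/negP => /BL.
rewrite big_cons -(cardsID (nbhd A a v) B) leq_add ?subset_leq_card ?subsetIr //.
apply: IHL => [|u]; first exact: subset_trans (subsetDl _ _) sBA.
rewrite !inE => /andP[+ Bu]; have := subsetP sBA u Bu; rewrite !inE => /andP[-> ->] /=.
by have := BL u Bu; rewrite inE => /predU1P[-> | //]; rewrite eqxx.
Qed.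

Definition mono_triangle (A : {set T}) : Prop :=
  exists x y z, [/\ x \in A, y \in A & z \in A] /\
    [/\ x != y, x != z, y != z, col x y = col x z & col y z = col x y].

Lemma ramsey33 (A : {set T}) a b : colored_by A [:: a; b] -> 5 < #|A| -> mono_triangle A.
Proof.
move=> Aab ltA; have /card_gt0P[v Av] : 0 < #|A| by apply: leq_trans ltA.
have nbhd3 a' b' : colored_by A [:: a'; b'] -> 2 < #|nbhd A a' v| -> mono_triangle A.
  move=> Aab' /card_gt2P[x [y [z [[/nbhdP[Ax xv vx] /nbhdP[Ay yv vy] /nbhdP[Az zv vz]]]]]].
  case=> xy yz zx.
  have tri p q : p \in A -> q \in A -> p != v -> q != v -> p != q -> col v p = a' ->
      col v q = a' -> col p q = a' -> mono_triangle A.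
    move=> Ap Aq pv qv pq vp vq cpq; exists v, p, q; split=> //.
    by rewrite ![v == _]eq_sym cpq vp vq.
  have := Aab' x y Ax Ay xy; rewrite !inE => /orP[/eqP cxy | /eqP cxy].
    exact: (tri x y).
  have := Aab' y z Ay Az yz; rewrite !inE => /orP[/eqP cyz | /eqP cyz].
    exact: (tri y z).
  have := Aab' z x Az Ax zx; rewrite !inE => /orP[/eqP czx | /eqP czx].
    exact: (tri z x).
  exists x, y, z; split=> //; rewrite xy yz eq_sym zx cxy cyz; split=> //.
  by rewrite colC.
have := card_nbhd Aab Av; rewrite big_cons big_seq1 => leA.
have [le2 | /(nbhd3 _ _ Aab) //] := leqP #|nbhd A a v| 2.
apply: (nbhd3 b a).
  by apply: colored_by_perm Aab; exact/permPl/(perm_catC [:: a] [:: b]).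
have := leq_trans ltA leA; rewrite add1n ltnS => lt.
by have := leq_trans lt (leq_add le2 (leqnn _)); rewrite (leq_add2l 2 3).
Qed.

Lemma no_mono_triangle (A : {set T}) L : ~ mono_star col -> colored_by A L ->
  {in A & L, forall v a, 4 < #|nbhd A a v|} -> ~ mono_triangle A.
Proof.
move=> nostar AL ltN [x [y [z [[Ax Ay Az] [xy xz yz cxz cyz]]]]].
have Ny : y \in nbhd A (col x y) x by apply/nbhdP; rewrite eq_sym.
have Nz : z \in nbhd A (col x y) x by apply/nbhdP; rewrite eq_sym.
have := nbhd_uncolored nostar (ltN x _ Ax (AL x y Ax Ay xy)) Ny Nz yz.
by rewrite cyz eqxx.
Qed.

Lemma card_nbhd_le (A : {set T}) a L v m : ~ mono_star col -> colored_by A (a :: L) ->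
  3 < m -> (forall B, colored_by B L -> #|B| <= m) -> #|nbhd A a v| <= m.
Proof.
move=> nostar AL lt3m IH; have [le4 | gt4] := leqP #|nbhd A a v| 4.
  exact: leq_trans le4 lt3m.
by apply: IH; apply: colored_nbhd gt4.
Qed.

Lemma card_one_color (A : {set T}) a : ~ mono_star col ->
  colored_by A [:: a] -> #|A| <= 5.
Proof.
move=> nostar Aa; have [-> | [v Av]] := set_0Vmem A; first by rewrite cards0.
apply: leq_trans (card_nbhd Aa Av) _; rewrite big_seq1 (leq_add2l 1 _ 4).
apply: (card_nbhd_le v nostar Aa) => // B B0.
apply: (leq_trans (n := 1)) => //; rewrite leqNgt; apply/negP.
by move=> /card_gt1P[x [y [Bx By /(B0 _ _ Bx By)]]].
Qed.

(** More than 10 vertices give total degree at least 10, and the other colour contributes at most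
    5. *)
Lemma large_nbhds2 (A : {set T}) a b v : ~ mono_star col -> colored_by A [:: a; b] ->
  10 < #|A| -> v \in A -> 4 < #|nbhd A a v|.
Proof.
move=> nostar Aab ltA Av; rewrite ltnNge; apply/negP => le4.
have Aba : colored_by A [:: b; a].
  by apply: colored_by_perm Aab; exact/permPl/(perm_catC [:: a] [:: b]).
have le5 : #|nbhd A b v| <= 5.
  by apply: (card_nbhd_le v nostar Aba) => // B; apply: card_one_color.
have := leq_trans ltA (card_nbhd Aab Av); rewrite big_cons big_seq1 ltnNge.
by rewrite (leq_add2l 1 _ 9) (leq_add le4 le5).
Qed.

Lemma card_two_colors (A : {set T}) a b : ~ mono_star col -> colored_by A [:: a; b] ->
  #|A| <= 10.
Proof.
move=> nostar Aab; rewrite leqNgt; apply/negP => ltA.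
have ltA6 : 5 < #|A| by apply: leq_trans ltA.
apply: (no_mono_triangle nostar Aab _ (ramsey33 Aab ltA6)) => v c Av.
rewrite !inE => /orP[] /eqP->; first exact: large_nbhds2 Aab ltA Av.
apply: (large_nbhds2 (b := a)) => //.
by apply: colored_by_perm Aab; exact/permPl/(perm_catC [:: a] [:: b]).
Qed.

(** The total degree is at least 25, and the other two colours contribute at most 10 each. *)
Lemma large_nbhds3 (A : {set T}) a b c v : ~ mono_star col ->
  colored_by A [:: a; b; c] -> 25 < #|A| -> v \in A -> 4 < #|nbhd A a v|.
Proof.
move=> nostar Aabc ltA Av; rewrite ltnNge; apply/negP => le4.
have lebc d e f : perm_eq [:: a; b; c] [:: d; e; f] -> #|nbhd A d v| <= 10.
  move=> /colored_by_perm/(_ Aabc) Adef.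
  by apply: (card_nbhd_le v nostar Adef) => // B; apply: card_two_colors.
have leb : #|nbhd A b v| <= 10.
  by apply: (lebc b c a); exact/permPl/(perm_catC [:: a] [:: b; c]).
have lec : #|nbhd A c v| <= 10.
  by apply: (lebc c a b); exact/permPl/(perm_catC [:: a; b] [:: c]).
have := leq_trans ltA (card_nbhd Aabc Av); rewrite !big_cons big_nil addn0 ltnNge.
by rewrite (leq_add2l 1 _ 24) (leq_add le4) // (leq_add leb).
Qed.

Lemma card_three_colors (A : {set T}) a b c : ~ mono_star col ->
  colored_by A [:: a; b; c] -> #|A| <= 25.
Proof.
move=> nostar Aabc; rewrite leqNgt; apply/negP => ltA.
have large d e f v : perm_eq [:: a; b; c] [:: d; e; f] -> v \in A -> 4 < #|nbhd A d v|.
  by move=> /colored_by_perm/(_ Aabc) Adef; apply: large_nbhds3 Adef ltA.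
have permb : perm_eq [:: a; b; c] [:: b; c; a].
  exact/permPl/(perm_catC [:: a] [:: b; c]).
have permc : perm_eq [:: a; b; c] [:: c; a; b].
  exact/permPl/(perm_catC [:: a; b] [:: c]).
have noT : ~ mono_triangle A.
  apply: (no_mono_triangle nostar Aabc) => v d Av; rewrite !inE => /or3P[] /eqP->.
  - exact: (large a b c).
  - exact: (large b c a).
  - exact: (large c a b).
have /card_gt0P[v Av] : 0 < #|A| by apply: leq_trans ltA.
(* Six neighbours in one colour would be coloured by the other two and contain a monochromatic
   triangle. Hence the total degree is at most 15. *)
have le5 d e f : perm_eq [:: a; b; c] [:: d; e; f] -> #|nbhd A d v| <= 5.
  move=> def; rewrite leqNgt; apply/negP => gt5; apply: noT.
  have Adef := colored_by_perm def Aabc.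
  have [x [y [z [[Nx Ny Nz] xyz]]]] :=
    ramsey33 (colored_nbhd nostar Adef (ltnW gt5)) gt5.
  by exists x, y, z; split=> //; split; [case/nbhdP: Nx | case/nbhdP: Ny | case/nbhdP: Nz].
have := leq_trans ltA (card_nbhd Aabc Av); rewrite !big_cons big_nil addn0 ltnNge.
rewrite (leq_add2l 1 _ 24) (leq_trans (n := 5 + (5 + 5))) // !leq_add //.
- exact: le5 (perm_refl _).
- exact: le5 permb.
- exact: le5 permc.
Qed.

End Ramsey.

(** * Exact colourings, and copies read as injections *)

Lemma exact_needs_colors n k (c : {set complete_graph n} -> 'I_k) d :
  exact_coloring c -> d < k -> needs_colors (edge_color c) d.
Proof.
move=> exc ltdk L sL; have [a aL] : exists a, a \notin L.
  apply/existsP; rewrite -negb_forall; apply: contraL ltdk => /forallP allL.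
  rewrite -leqNgt -[k]card_ord cardE; apply: leq_trans sL.
  by apply: uniq_leq_size (enum_uniq _) _ => a _; apply: allL.
have [e /edgesP[x [y [xy ->]]] ca] := exc a.
by exists x, y; split=> //; rewrite /edge_color ca.
Qed.

Lemma has_rainbow_P5E n k (c : {set complete_graph n} -> 'I_k) :
  has_rainbow (path_graph 5) c -> exists2 f : 'I_5 -> 'I_n, injective f &
    {in gtn 4 &, injective (fun i => edge_color c (f (inord i)) (f (inord i.+1)))}.
Proof.
case=> f [injf _] injc; exists f => // i j lti4 ltj4 /=.
have E m : m < 4 -> [set inord m; inord m.+1 : 'I_5] \in edges (path_graph 5).
  by move=> ltm4; apply/path_edgesP; exists m.
rewrite /edge_color -!(imset_set1 f) -!imsetU => /(injc _ _ (E i lti4) (E j ltj4)) eij.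
have sub p q : p < 4 -> q < 4 ->
    [set inord p; inord p.+1 : 'I_5] = [set inord q; inord q.+1] -> q <= p <= q.+1.
  move=> ltp4 ltq4 /setP/(_ (inord p)); rewrite !inE eqxx -!val_eqE /=.
  rewrite !inordK ?(leqW ltp4) ?(leqW ltq4) // => /esym/orP[] /eqP->;
    by rewrite leqnn leqnSn.
have /andP[leji _] := sub i j lti4 ltj4 eij.
have /andP[leij _] := sub j i ltj4 lti4 (esym eij).
by apply/eqP; rewrite eqn_leq leij.
Qed.

Lemma has_monochromatic_starE n k (c : {set complete_graph n} -> 'I_k) :
  has_monochromatic (star_graph 6 1) c -> exists2 f : 'I_6 -> 'I_n, injective f &
    exists a, (forall j, j != ord0 -> edge_color c (f ord0) (f j) = a) /\
      edge_color c (f (inord 1)) (f (inord 2)) = a.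
Proof.
case=> f [injf _] [a ca]; exists f => //; exists a; split=> [j j0|];
  rewrite /edge_color -!(imset_set1 f) -!imsetU; apply: ca; apply/edgesP.
  exists (ord0 : 'I_6), j; split=> //.
  by apply/orP; left; rewrite /star_edge lt0n j0.
exists (inord 1), (inord 2); split=> //.
by rewrite /= /star_adj /star_edge !inordK.
Qed.

(** * Extremal colourings *)

(** The ordered pair picked from an edge is arbitrary, which is harmless for symmetric [g]. *)
Definition coloring_of n k (g : nat -> nat -> nat)
    (e : {set complete_graph n}) : 'I_k.+1 :=
  if [pick p : 'I_n * 'I_n | e == [set p.1; p.2]] is Some p then inord (g p.1 p.2)
  else ord0.

Lemma coloring_ofE n k (g : nat -> nat -> nat) (x y : 'I_n) :
  (forall i j, g i j = g j i) ->
  edge_color (@coloring_of n k g) x y = inord (g x y).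
Proof.
move=> gC; rewrite /edge_color /coloring_of; case: pickP => [[u v] /= | /(_ (x, y))].
  move=> /eqP/setP E; have := E x; have := E y; have := E u; have := E v.
  rewrite !inE !eqxx ?orbT /= => /orP Ev /orP Eu /esym/orP Ey /esym/orP Ex.
  by case: Ex Ey Eu Ev => /eqP ? [] /eqP ? [] /eqP ? [] /eqP ?; subst; rewrite // gC.
by rewrite eqxx.
Qed.

Lemma four_le_rainbow_P5 n k (c : {set complete_graph n} -> 'I_k) :
  has_rainbow (path_graph 5) c -> 4 <= k.
Proof.
case/has_rainbow_P5E=> f _ injc; rewrite -[4]card_ord -[k]card_ord.
by apply: (leq_card (fun i : 'I_4 => _)) => i j /(injc _ _ (ltn_ord i) (ltn_ord j))/val_inj.
Qed.

(* The blow-up of the 5-cycle: vertex i belongs to the class i %/ 5.           *)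
Definition blowup_color (i j : nat) : nat :=
  let d := (i %/ 5 - j %/ 5) + (j %/ 5 - i %/ 5) in
  if d == 0 then 2 else if (d == 1) || (d == 4) then 0 else 1.

Lemma blowup_colorC i j : blowup_color i j = blowup_color j i.
Proof. by rewrite /blowup_color addnC. Qed.

Lemma blowup_exact : exact_coloring (@coloring_of 25 2 blowup_color).
Proof.
have E (x y : 'I_25) a : x != y -> blowup_color x y = a :> nat ->
    exists2 e, e \in edges (complete_graph 25) & coloring_of 2 blowup_color e = inord a.
  move=> xy <-; exists [set x; y]; first by apply/edgesP; exists x, y.
  exact: (coloring_ofE 2 x y blowup_colorC).
move=> a; rewrite -[a]inord_val; case: a => -[|[|[|]]] // _ /=.
- by apply: (E (inord 0) (inord 5)); rewrite -?val_eqE /= !inordK.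
- by apply: (E (inord 0) (inord 10)); rewrite -?val_eqE /= !inordK.
- by apply: (E (inord 0) (inord 1)); rewrite -?val_eqE /= !inordK.
Qed.

(** The 5-cycle and its complement are triangle-free, so only the colour inside the classes has
    triangles. *)
Lemma blowup_triangle x y z : x < 25 -> y < 25 -> z < 25 ->
  blowup_color x y = blowup_color x z -> blowup_color y z = blowup_color x y ->
  blowup_color x y = 2.
Proof.
move=> x25 y25 z25; rewrite /blowup_color.
have div5 u : u < 25 -> u %/ 5 \in iota 0 5 by move=> u25; rewrite mem_iota ltn_divLR.
move: (div5 x x25) (div5 y y25) (div5 z z25); move: (x %/ 5) (y %/ 5) (z %/ 5).
move=> p q r; rewrite !inE.
by do 3![case/or4P=> [/eqP->|/eqP->|/eqP->|/orP[/eqP->|/eqP->]]].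
Qed.

(** The triangle forces colour 2, so all six vertices of the star would lie in one class of five. *)
Lemma blowup_no_star :
  ~ has_monochromatic (star_graph 6 1) (@coloring_of 25 2 blowup_color).
Proof.
case/has_monochromatic_starE=> f injf [a [c0 c12]].
have E x y (xy : edge_color (@coloring_of 25 2 blowup_color) x y = a) :
    blowup_color x y = a.
  move: xy; rewrite (coloring_ofE 2 x y blowup_colorC) => <-; rewrite inordK //.
  by rewrite /blowup_color; case: ifP => // _; case: ifP.
have {}c0 j : j != ord0 -> blowup_color (f ord0) (f j) = a by move=> /c0/E.
have n1 : inord 1 != ord0 :> 'I_6 by rewrite -val_eqE /= inordK.
have n2 : inord 2 != ord0 :> 'I_6 by rewrite -val_eqE /= inordK.
have a2 : a = 2 :> nat.
  rewrite -(c0 _ n1); apply: (blowup_triangle (z := f (inord 2))) => //;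
  by rewrite ?(E _ _ c12) !c0.
have part j : f j %/ 5 = f ord0 %/ 5.
  have [-> // | /c0] := eqVneq j ord0; rewrite a2 /blowup_color.
  case: ifP => [|_]; last by case: ifP.
  by rewrite addn_eq0 !subn_eq0 -eqn_leq => /eqP.
have: #|'I_6| <= #|'I_5|.
  apply: (leq_card (fun j => inord (f j %% 5) : 'I_5)) => i j /(congr1 val).
  rewrite /= !inordK ?ltn_mod // => eq_mod; apply/injf/val_inj.
  by rewrite /= (divn_eq (f i) 5) (divn_eq (f j) 5) !part eq_mod.
by rewrite !card_ord.
Qed.

(* {0, j} has colour minn j k, and edges that avoid 0 have colour 0.           *)
Definition pendant_color (k i j : nat) : nat :=
  minn (if minn i j == 0 then maxn i j else 0) k.

Lemma pendant_colorC k i j : pendant_color k i j = pendant_color k j i.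
Proof. by rewrite /pendant_color (minnC i) (maxnC i). Qed.

Lemma pendantE k (x y : 'I_6) :
  edge_color (@coloring_of 6 k (pendant_color k)) x y = pendant_color k x y :> nat.
Proof.
rewrite (coloring_ofE k x y (pendant_colorC k)) inordK //.
by rewrite ltnS geq_minr.
Qed.

Lemma pendant_exact k : k <= 5 -> exact_coloring (@coloring_of 6 k (pendant_color k)).
Proof.
move=> k5 a; have E (x y : 'I_6) : x != y -> pendant_color k x y = a ->
    exists2 e, e \in edges (complete_graph 6) & coloring_of k (pendant_color k) e = a.
  move=> xy xya; exists [set x; y]; first by apply/edgesP; exists x, y.
  by apply: val_inj; rewrite /= -xya -pendantE.
have [a0 | a_gt0] := posnP a.
  by apply: (E (inord 1) (inord 2)); rewrite -?val_eqE /= !inordK // a0 /pendant_color min0n.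
have lta6 : a < 6 by apply: leq_trans (ltn_ord a) _.
apply: (E ord0 (inord a)); rewrite -?val_eqE /= inordK //; first by rewrite eq_sym -lt0n.
by rewrite /pendant_color min0n max0n /=; apply/minn_idPl; rewrite -ltnS.
Qed.

(** A path on five vertices meets 0 at most once, so at least two of its four edges avoid 0 and
    share colour 0. *)
Lemma pendant_no_rainbow k :
  ~ has_rainbow (path_graph 5) (@coloring_of 6 k (pendant_color k)).
Proof.
case/has_rainbow_P5E=> f injf injc.
pose z i := f (inord i) == ord0.
have zz i j : i < 5 -> j < 5 -> i != j -> z i -> ~~ z j.
  move=> lti5 ltj5 ij /eqP zi; apply: contra ij => /eqP zj.
  have /injf/(congr1 val) : f (inord i) = f (inord j) by rewrite zi.
  by rewrite /= !inordK // => ->.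
have col0 i j : i < 4 -> j < 4 -> i != j -> ~~ z i -> ~~ z i.+1 -> ~~ z j -> z j.+1.
  move=> lti4 ltj4 ij zi zi1 zj; apply: contraNT ij => zj1; apply/eqP.
  have zero m : ~~ z m -> ~~ z m.+1 ->
      edge_color (@coloring_of 6 k (pendant_color k)) (f (inord m)) (f (inord m.+1)) = ord0.
    move=> zm zm1; apply: val_inj; rewrite /= pendantE /pendant_color.
    rewrite gtn_eqF ?min0n // leq_min !lt0n.
    by rewrite -[_ == 0]/(z m) -[_ == 0]/(z m.+1) zm.
  by apply: injc; rewrite // !zero.
have {}col0 i j : i < 4 -> j < 4 -> i != j -> [|| z i, z i.+1, z j | z j.+1].
  move=> lti4 ltj4 ij; apply/negPn; rewrite !negb_or.
  by apply/negP => /and4P[zi zi1 zj]; rewrite (col0 i j).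
have := col0 0 1 isT isT isT; have := col0 2 3 isT isT isT; have := col0 0 3 isT isT isT.
have z01 := zz 0 1 isT isT isT; have z02 := zz 0 2 isT isT isT.
have z03 := zz 0 3 isT isT isT; have z04 := zz 0 4 isT isT isT.
have z12 := zz 1 2 isT isT isT; have z13 := zz 1 3 isT isT isT.
have z14 := zz 1 4 isT isT isT; have z23 := zz 2 3 isT isT isT.
have z24 := zz 2 4 isT isT isT; have z34 := zz 3 4 isT isT isT.
case: (z 0) z01 z02 z03 z04 => [/(_ isT)/negPf-> /(_ isT)/negPf->|_ _ _ _].
  by move=> /(_ isT)/negPf-> /(_ isT)/negPf->.
case: (z 1) z12 z13 z14 => [/(_ isT)/negPf-> /(_ isT)/negPf-> /(_ isT)/negPf-> //|_ _ _].
case: (z 2) z23 z24 => [/(_ isT)/negPf-> /(_ isT)/negPf-> //|_ _].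
by case: (z 3) z34 => [/(_ isT)/negPf-> |_]; case: (z 4).
Qed.

(** The star spans all six vertices, so its centre sees one colour only. But 0 sees colours 1 and 2,
    and any other vertex sees colour 0 and the nonzero colour of its edge to 0. *)
Lemma pendant_no_star k : 2 < k ->
  ~ has_monochromatic (star_graph 6 1) (@coloring_of 6 k (pendant_color k)).
Proof.
move=> k2 /has_monochromatic_starE[f injf [a [c0 _]]].
have {}c0 j : j != ord0 -> pendant_color k (f ord0) (f j) = a.
  by move=> /c0 <-; rewrite pendantE.
pose g := invF injf; have gK x : f (g x) = x by apply: f_invF.
have g0 x : x != f ord0 -> pendant_color k (f ord0) x = a.
  move=> xf0; rewrite -(gK x) c0 //; apply: contra xf0 => /eqP <-.
  by rewrite gK.
have n1 : inord 1 != ord0 :> 'I_6 by rewrite -val_eqE /= inordK.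
have n2 : inord 2 != ord0 :> 'I_6 by rewrite -val_eqE /= inordK.
have [f0 | f0] := eqVneq (f ord0) ord0.
  have := g0 (inord 1); rewrite f0 => /(_ n1) a1.
  have := g0 (inord 2); rewrite f0 => /(_ n2); rewrite -a1 /pendant_color !inordK //.
  by rewrite !min0n !max0n /= (minn_idPl (ltnW k2)) (minn_idPl (ltnW (ltnW k2))).
pose x : 'I_6 := if f ord0 == inord 1 then inord 2 else inord 1.
have xf0 : x != f ord0.
  by rewrite /x; case: ifPn => [/eqP-> | ]; rewrite 1?eq_sym // -val_eqE /= !inordK.
have x0 : x != ord0 by rewrite /x; case: ifP.
have := g0 ord0; rewrite eq_sym => /(_ f0); rewrite -(g0 x xf0) /pendant_color.
rewrite minn0 maxn0 eqxx gtn_eqF ?leq_min ?lt0n ?f0 ?x0 // min0n => /eqP.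
by rewrite gtn_eqF // leq_min lt0n f0 ltnW // ltnW.
Qed.

(** * The ceiling formula and the three ranges of [k] *)

Import Order.TTheory GRing.Theory Num.Theory.

(** The real number is the positive root of [x * (x - 1) = 2 * k]. For [M.+1] the comparison becomes
    [1 + 8 * k <= (2 * M + 1) ^ 2]. *)
Lemma ceil_bin2 (R : realType) (k M : nat) : 0 < k ->
  (`|Num.ceil ((1 + Num.sqrt (1 + 8 * k%:R)) / 2 : R)%R|%N <= M) = (k <= 'C(M, 2)).
Proof.
move=> k_gt0; set r := (_ / 2 : R)%R.
have r_gt0 : (0 < r)%R by rewrite divr_gt0 // ltr_wpDr ?sqrtr_ge0.
have -> : (`|Num.ceil r|%N <= M) = (r <= M%:R)%R.
  rewrite -lez_nat gez0_abs ?ceil_ge0 ?(lt_trans _ r_gt0) ?ltrN10 //.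
  by rewrite ceil_le_int.
case: M => [|M]; first by rewrite bin_small // leqNgt k_gt0 leNgt r_gt0.
have -> : (k <= 'C(M.+1, 2)) = (k * 2 <= M.+1 * M).
  have := bin_ffact M.+1 2; rewrite !ffactnS ffactn0 muln1 /= => <-.
  by rewrite leq_pmul2r.
rewrite ler_pdivrMr // -lerBrDl.
have -> : (M.+1%:R * 2 - 1 = M.*2.+1%:R :> R)%R.
  by rewrite -natrM -[1%R]/(1%:R)%R -natrB //; congr (_%:R)%R; lia.
rewrite -[X in (_ <= X)%R](ger0_norm (ler0n _ _)) -sqrtr_sqr ler_sqrt ?exprn_ge0 //.
by rewrite -natrX -natrM -[1%R]/(1%:R)%R -natrD ler_nat; nia.
Qed.

Theorem theorem3p8 (R : realType) (k : nat) (hk : 3 <= k) :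
  is_gallai_ramsey k (path_graph 5) (star_graph 6 1)
    (if k == 3 then 26
     else if k <= 6 then 7
     else `|Num.ceil ((1 + Num.sqrt (1 + 8 * k%:R)) / 2 : R)%R|%N).
Proof.
have conv n (c : {set complete_graph n} -> 'I_k) :
    rainbow_P5 (edge_color c) \/ mono_star (edge_color c) ->
    has_rainbow (path_graph 5) c \/ has_monochromatic (star_graph 6 1) c.
  case=> [/rainbow_P5_has_rainbow | /mono_star_has_monochromatic]; first by left.
  by right.
have [k3 | k_neq3] := eqVneq k 3.
  subst k; split=> [|M [_ HM]].
    split=> // n len c _; apply: conv; right; apply: boolp.contrapT => nostar.
    have := @card_three_colors 'I_n 'I_3 (edge_color c) (edge_colorC c) setT ord0
      (inord 1) (inord 2) nostar.
    rewrite cardsT card_ord leqNgt len => /(_ _)/negP; apply => // x y _ _ _.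
    by rewrite -(inord_val (edge_color c x y)) !inE -!val_eqE /= !inordK //;
      case: (edge_color c x y) => -[|[|[]]].
  rewrite leqNgt; apply/negP => leM.
  case: (HM 25 leM (coloring_of 2 blowup_color) blowup_exact).
    by move/four_le_rainbow_P5.
  exact: blowup_no_star.
have k4 : 3 < k by rewrite ltn_neqAle eq_sym k_neq3.
have [k6 | k7] := leqP k 6.
  split=> [|M [_ HM]].
    split=> [|n len c exc]; first exact: leq_trans k6 _.
    apply: conv; apply: four_colors_P5_or_star; first exact: edge_colorC.
      by rewrite card_ord.
    exact: exact_needs_colors exc k4.
  (* [coloring_of] uses [k.+1] colours, so from here [k] is one less than the number of colours. *)
  rewrite leqNgt; apply/negP => leM; case: k hk k4 k6 HM {conv k_neq3} => // k hk k4 k6 HM.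
  case: (HM 6 leM (coloring_of k (pendant_color k)) (pendant_exact k6)).
    exact: pendant_no_rainbow.
  exact: pendant_no_star.
have k_gt0 : 0 < k by apply: leq_trans hk.
split=> [|M [leM _]]; last by rewrite ceil_bin2.
have le_bin := ceil_bin2 R _ k_gt0.
split=> [|n]; first by rewrite -le_bin.
rewrite le_bin => len c exc; apply: conv; apply: seven_colors_P5_or_star.
- exact: edge_colorC.
(* At least five vertices, since ['C(4, 2) = 6] is less than 7. *)
- rewrite card_ord ltnNge; apply: contraL (leq_trans k7 len) => len4.
  by rewrite -leqNgt; apply: leq_trans (leq_bin2l 2 len4) _.
- exact: exact_needs_colors exc k7.
Qed.
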